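(* Let $n,T\ge 1$ and let $z_1,\ldots,z_{n+1}$ be positive reals with $z_1+\cdots+z_{n+1}=1$; put $y_2=z_1+z_2$. In the stationary distribution of the overwriting Markov chain on $St_n^T$ described in the context, for $w=w_1\cdots w_n$: $$\mathbb{P}(w_n=j)=\begin{cases} z_1(1-z_1)^{j-1} & j<T,\\ (1-z_1)^{T-1} & j=T,\end{cases}$$ and, for $n\ge2$ and $i,j\in\{1,\ldots,T\}$, $$\mathbb{P}(w_{n-1}=i,\,w_n=j)=(1-z_1)^{\max(i,j)-1}(1-y_2)^{\min(i,j)-1}\times\begin{cases} z_1y_2 & i<j<T,\\ z_1^2 & j\le i<T,\\ y_2 & i<j=T,\\ z_1 & j<i=T,\\ 1 & i=j=T.\end{cases}$$
   Context: $St_n^T$ is the set of all words of length $n$ over $\{1,\ldots,T\}$. Let $y_i=z_1+\cdots+z_i$ ($y_0=0$). For $w\in St_n^T$ set $w_{n+1}=+\infty$ and $J_w(m,t)=1+\#\{\ell:\ m\le\ell\le n,\ w_\ell>t\}$. An overwriting sequence for $w$ is a sequence $B=((b_1,t_1),\ldots,(b_k,t_k))$ with $1<b_1<\cdots<b_k=n+1$, $1\le t_1<\cdots<t_k\le T$ and $t_j<w_{b_j}$ for all $j$. The word $w^B$ is defined by $w^B_i=t_j$ if $i=b_j-1$ for some $j$, and $w^B_i=w_{i+1}$ otherwise. With the conventions $b_0=1$, $t_0=0$, the transition probability from $w$ to $w^B$ is $$\prod_{j=1}^k\Bigl(\prod_{\ell=t_{j-1}+1}^{t_j-1}\bigl(1-y_{J_w(b_{j-1}+1,\ell)}\bigr)\Bigr)\prod_{j:\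 t_j\ne T} z_{J_w(b_j,t_j)},$$ and transitions to words not of the form $w^B$ have probability $0$ ($B$ is determined by $w^B$). (Interpretation: the first letter is erased and the rest shifted left; the juggler successively tries to send balls of types $1,2,\ldots,T-1$, each to the $i$-th position from the right (chosen with probability $z_i$) among positions to the right of the previous landing spot currently holding a larger letter, overwriting it; she stops once a ball lands in the rightmost position, and puts a $T$ there if none did.) *)

(* Defs.v *)
From HB Require Import structures.
From mathcomp Require Import all_boot all_order all_algebra.

Set Implicit Arguments.
Unset Strict Implicit.
Unset Printing Implicit Defensive.

Import Order.TTheory GRing.Theory Num.Theory.
Local Open Scope ring_scope.

(* A letter a : 'I_T stands for the integer a.+1 of {1, ..., T}. *)
Definition word (n T : nat) : finType := n.-tuple 'I_T.

(* Positions are numbered from 1.  At position n.+1 the value is T.+1, which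
   plays the role of +oo: it is only ever compared with types t <= T. *)
Definition letter (n T : nat) (w : word n T) (m : nat) : nat :=
  nth T.+1 [seq (val a).+1 | a <- w] m.-1.

Definition partial_sum (R : realFieldType) (z : nat -> R) (i : nat) : R :=
  \sum_(1 <= l < i.+1) z l.

Definition J (n T : nat) (w : word n T) (m t : nat) : nat :=
  (1 + count (fun l => t < letter w l) (index_iota m n.+1))%N.

(* Finite sequences ((b_1, t_1), ..., (b_k, t_k)) with b_j <= n.+1, t_j <= T.
   The bound k <= n is implied by 1 < b_1 < ... < b_k = n.+1. *)
Definition pair_seq (n T : nat) : finType := n.-bseq ('I_n.+2 * 'I_T.+1)%type.

Section PairSeq.
Variables n T : nat.
Implicit Types (w : word n T) (B : pair_seq n T).

Definition bs B : seq nat := [seq val p.1 | p <- B].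
Definition ts B : seq nat := [seq val p.2 | p <- B].

(* b_j and t_j for 0 <= j <= k, with b_0 = 1 and t_0 = 0. *)
Definition b_at B (j : nat) : nat := nth 0%N (1%N :: bs B) j.
Definition t_at B (j : nat) : nat := nth 0%N (0%N :: ts B) j.

(* As n >= 1, the condition on the last b_j forces B to be nonempty. *)
Definition overwriting w B : bool :=
  [&& path ltn 1%N (bs B), last 1%N (bs B) == n.+1, path ltn 0%N (ts B)
    & all (fun p : 'I_n.+2 * 'I_T.+1 => p.2 < letter w p.1)%N B].

Definition overwrite w B (i : nat) : nat :=
  if i.+1 \in bs B then nth 0%N (ts B) (index i.+1 (bs B)) else letter w i.+1.

Definition is_overwrite w B (w' : word n T) : bool :=
  [forall i : 'I_n, letter w' i.+1 == overwrite w B i.+1].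

Definition weight (R : realFieldType) (z : nat -> R) w B : R :=
  (\prod_(1 <= j < (size B).+1)
     \prod_((t_at B j.-1).+1 <= l < t_at B j)
        (1 - partial_sum z (J w (b_at B j.-1).+1 l)))
  * \prod_(1 <= j < (size B).+1 | t_at B j != T) z (J w (b_at B j) (t_at B j)).

(* B is determined by w and w^B, so the sum has at most one term. *)
Definition transition (R : realFieldType) (z : nat -> R) w (w' : word n T) : R :=
  \sum_(B : pair_seq n T | overwriting w B && is_overwrite w B w') weight z w B.

Definition stationary (R : realFieldType) (z : nat -> R)
    (pi : {ffun word n T -> R}) : Prop :=
  [/\ forall w, 0 <= pi w,
      \sum_w pi w = 1
    & forall w', \sum_w pi w * transition z w w' = pi w'].

Definition prob (R : realFieldType) (pi : {ffun word n T -> R})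
    (A : pred (word n T)) : R :=
  \sum_(w | A w) pi w.

End PairSeq.

(* Main.v *)
Require Import Defs.
From HB Require Import structures.
From mathcomp Require Import all_boot all_order all_algebra.
From mathcomp Require Import zify ring.

Set Implicit Arguments.
Unset Strict Implicit.
Unset Printing Implicit Defensive.

Import Order.TTheory GRing.Theory Num.Theory.
Local Open Scope ring_scope.

(* The chain is stochastic, and appending the letter T always has positive
   probability, so every word leads to the constant word T...T: the stationary
   distribution exists and is unique.

   Trying the ball types one at a time turns the sum over overwriting sequences
   into a recursion on the type.  The rightmost spot is always available and is
   hit with probability z_1, whatever the word, so the new last letter exceeds
   i < T with probability (1 - z_1)^i.  The spot next to it holds the old last
   letter c and is available, with probability z_2, exactly to the types t < c
   as long as it has not been overwritten.  Hence the law of the last two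
   letters of the new word depends on the old word through c only, and it
   remains to average over the law of c, which is known by stationarity. *)

(** * Stationary distributions of finite chains *)

Section StochasticMatrix.
Variables (R : realFieldType) (S : finType) (P : S -> S -> R).
Hypothesis P_ge0 : forall s s', 0 <= P s s'.
Hypothesis P_row : forall s, \sum_s' P s s' = 1.

Definition invariant_vec (v : S -> R) := forall s', \sum_s v s * P s s' = v s'.

(** The triangle inequality gives [|v| <= |v| P] entrywise, and both sides have the same total
    because the rows of [P] sum to 1. *)
Lemma invariant_vec_norm v : invariant_vec v -> invariant_vec (fun s => `|v s|).
Proof.
move=> v_inv s'; apply/eqP; rewrite eq_sym.
have le_norm t : `|v t| <= \sum_s `|v s| * P s t.
  rewrite -{1}v_inv; apply: le_trans (ler_norm_sum _ _ _) _.
  by apply: ler_sum => s _; rewrite normrM (ger0_norm (P_ge0 _ _)).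
have /eqP : \sum_t (\sum_s `|v s| * P s t - `|v t|) = 0.
  rewrite sumrB exchange_big /= -[RHS](subrr (\sum_t `|v t|)); congr (_ - _).
  by apply: eq_bigr => s _; rewrite -mulr_sumr P_row mulr1.
rewrite psumr_eq0; last by move=> t _; rewrite subr_ge0.
by move=> /allP /(_ s' (mem_index_enum _)) /=; rewrite subr_eq0 eq_sym.
Qed.

(** Row sums equal to 1 put the constant vector in the kernel of [P - 1], so the determinant
    vanishes and some nonzero row vector is killed as well. *)
Lemma exists_invariant_vec (s0 : S) :
  exists2 v, invariant_vec v & exists s, v s != 0.
Proof.
pose n := #|S|.
pose M : 'M[R]_n := \matrix_(i, j) P (enum_val i) (enum_val j) - 1%:M.
have M1 : \det M = 0.
  apply/eqP; rewrite -det_tr; apply/det0P.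
  exists (const_mx 1).
    apply/negP => /eqP /rowP /(_ (enum_rank s0)); rewrite !mxE => /eqP.
    by rewrite oner_eq0.
  apply/rowP => i; rewrite !mxE.
  under eq_bigr => k _ do rewrite !mxE mul1r.
  rewrite sumrB [X in _ - X](bigD1 i) //= eqxx [X in _ - (_ + X)]big1.
    rewrite addr0 -(big_enum_val (fun s => P (enum_val i) s)) /=.
    by rewrite P_row subrr.
  by move=> k /negPf nki; rewrite eq_sym nki.
have /det0P[v v_neq0 vM] : \det M == 0 by rewrite M1.
exists (fun s => v 0 (enum_rank s)); last first.
  case: (altP (rV0Pn v)) v_neq0 => // -[i vi] _.
  by exists (enum_val i); rewrite enum_valK.
move=> s'; move/rowP/(_ (enum_rank s')): vM; rewrite mulmxBr mulmx1 !mxE.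
move/eqP; rewrite subr_eq0 => /eqP <-.
rewrite (big_enum_val (fun s => v 0 (enum_rank s) * P s s')) /=.
by apply: eq_bigr => i _; rewrite mxE !enum_rankK enum_valK.
Qed.

Lemma invariant_vec_gt0 v s s' : (forall t, 0 <= v t) -> invariant_vec v ->
  connect (fun t t' => 0 < P t t') s s' -> 0 < v s -> 0 < v s'.
Proof.
move=> v_ge0 v_inv /connectP[p + ->].
elim: p s => //= t p IHp s /andP[Pst pt] vs; apply: IHp pt _.
rewrite -v_inv (bigD1 s) //=; apply: ltr_pwDl; first exact: mulr_gt0.
by apply: sumr_ge0 => u _; apply: mulr_ge0.
Qed.

Variable s0 : S.
Hypothesis P_connect : forall s, connect (fun t t' => 0 < P t t') s s0.

(* The positive and negative parts of v are invariant with disjoint supports,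
   and s0 lies in the support of each one that does not vanish. *)
Lemma invariant_vec_eq0 v : invariant_vec v -> \sum_s v s = 0 -> forall s, v s = 0.
Proof.
move=> v_inv v_sum.
pose part (e : R) s : R := `|v s| + e * v s.
have part_inv e : invariant_vec (part e).
  move=> s'; rewrite /part.
  under eq_bigr => s _ do rewrite mulrDl -mulrA.
  by rewrite big_split /= -mulr_sumr v_inv invariant_vec_norm.
have part_ge0 e s : e \in [:: 1; -1] -> 0 <= part e s.
  rewrite /part !inE => /orP[]/eqP->.
    by rewrite mul1r -[v s]opprK subr_ge0 normrN ler_norm.
  by rewrite mulN1r subr_ge0 ler_norm.
have [e e_in part0] : exists2 e, e \in [:: 1; -1] & part e s0 = 0.
  case: (lerP 0 (v s0)) => vs0.
    by exists (-1); rewrite ?inE ?eqxx ?orbT // /part ger0_norm // mulN1r subrr.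
  by exists 1; rewrite ?inE ?eqxx // /part ltr0_norm // mul1r addNr.
have partE s : part e s = 0.
  apply/eqP; rewrite eq_le part_ge0 // andbT leNgt; apply/negP => pos.
  have := invariant_vec_gt0 (fun t => part_ge0 e t e_in) (part_inv e)
            (P_connect s) pos.
  by rewrite part0 ltxx.
(* As [part e] vanishes, [|v|] equals [- e * v], whose total is 0. *)
have norm_sum : \sum_s `|v s| = 0.
  transitivity (\sum_s part e s); last by rewrite big1.
  by rewrite big_split /= -mulr_sumr v_sum mulr0 addr0.
move=> s; apply/eqP; rewrite -normr_eq0.
have /eqP := norm_sum; rewrite psumr_eq0 // => /allP /(_ s (mem_index_enum _)).
by [].
Qed.

Lemma exists_invariant_distribution : exists pi : {ffun S -> R},
  [/\ forall s, 0 <= pi s, \sum_s pi s = 1 & invariant_vec pi].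
Proof.
have [v v_inv [s1 vs1]] := exists_invariant_vec s0.
pose N := \sum_s `|v s|.
have N_gt0 : 0 < N.
  rewrite /N (bigD1 s1) //=; apply: ltr_pwDl; first by rewrite normr_gt0.
  by apply: sumr_ge0.
exists [ffun s => N^-1 * `|v s|]; split.
- by move=> s; rewrite ffunE mulr_ge0 // invr_ge0 ltW.
- under eq_bigr => s _ do rewrite ffunE.
  by rewrite -mulr_sumr mulVf // gt_eqF.
- move=> s'; rewrite ffunE -(invariant_vec_norm v_inv s') mulr_sumr.
  by apply: eq_bigr => s _; rewrite ffunE mulrA.
Qed.

End StochasticMatrix.

(** * Sums over overwriting sequences *)

Section BigBseq.
Variables (V : nmodType) (X : finType) (G : seq X -> V).

Lemma big_bseq0 : \sum_(B : 0.-bseq X) G B = G [::].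
Proof.
have all0 (B : 0.-bseq X) : B = [bseq].
  by apply: val_inj; apply/nilP; rewrite /nilp -leqn0 size_bseq.
by rewrite (bigD1 [bseq]) //= big1 ?addr0 // => B; rewrite (all0 B) eqxx.
Qed.

Lemma big_bseqS m : \sum_(B : m.+1.-bseq X) G B =
  G [::] + \sum_(x : X) \sum_(B : m.-bseq X) G (x :: B).
Proof.
rewrite -(big_map (fun B : m.+1.-bseq X => val B) xpredT G).
pose r := [seq x :: bseqval B | x <- index_enum X, B <- index_enum (m.-bseq X)].
rewrite (perm_big ([::] :: r)) /=; last first.
  apply: uniq_perm.
  - by rewrite map_inj_uniq ?index_enum_uniq //; apply: val_inj.
  - rewrite /= allpairs_uniq ?index_enum_uniq //.
      by rewrite andbT; apply/allpairsPdep => -[x [B []]].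
    by move=> [x B] [y C] _ _ /= [-> /val_inj ->].
  - move=> s; rewrite inE; apply/mapP/idP => [[B _ ->]|].
      case: B => -[|x s'] // sz; rewrite orFb; apply/allpairsPdep.
      by exists x, (Bseq (sz : (size s' <= m)%N)); rewrite !mem_index_enum.
    case/orP => [/eqP->|/allpairsPdep[x [B [_ _ ->]]]].
      by exists [bseq]; rewrite ?mem_index_enum.
    by exists [bseq of x :: B]; rewrite ?mem_index_enum.
by rewrite big_cons big_allpairs_dep.
Qed.

End BigBseq.

(** * A single transition, decomposed by ball type *)

Section OneStep.
Variables (R : realFieldType) (n T : nat) (z : nat -> R) (w : word n T).
Local Notation X := ('I_n.+2 * 'I_T.+1)%type.
Implicit Types s : seq X.

Definition fail_prob b l : R := 1 - partial_sum z (J w b.+1 l).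
(** Type [T] counts 1: it is put in the last place once every throw has failed, without a throw of
    its own. *)
Definition land_prob b t : R := if t == T then 1 else z (J w b t).
Definition step_prob b0 t0 b t : R :=
  (\prod_(t0.+1 <= l < t) fail_prob b0 l) * land_prob b t.

(** The free pair [(b0, t0)], standing for the previous landing, makes the product of weights
    recursive in the sequence. *)
Fixpoint weight_from b0 t0 s : R :=
  if s is p :: s' then step_prob b0 t0 p.1 p.2 * weight_from p.1 p.2 s' else 1.

Definition overwriting_from b0 t0 s : bool :=
  [&& path ltn b0 [seq val p.1 | p <- s],
      last b0 [seq val p.1 | p <- s] == n.+1,
      path ltn t0 [seq val p.2 | p <- s]
    & all (fun p : X => p.2 < letter w p.1)%N s].

Lemma overwriting_from_cons b0 t0 p s : overwriting_from b0 t0 (p :: s) =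
  [&& (b0 < p.1)%N, (t0 < p.2)%N, (p.2 < letter w p.1)%N
    & overwriting_from p.1 p.2 s].
Proof.
rewrite /overwriting_from /=; case: (b0 < p.1)%N => //=.
by case: (t0 < p.2)%N; case: (p.2 < letter w p.1)%N; rewrite /= ?andbF.
Qed.

Lemma weightE (B : pair_seq n T) : weight z w B = weight_from 1 0 B.
Proof.
rewrite /weight /t_at /b_at /bs /ts.
suff gen s b0 t0 (bl := b0 :: [seq val p.1 | p <- s])
    (tl := t0 :: [seq val p.2 | p <- s]) :
  (\prod_(1 <= j < (size s).+1)
     \prod_((nth 0%N tl j.-1).+1 <= l < nth 0%N tl j)
        fail_prob (nth 0%N bl j.-1) l)
  * \prod_(1 <= j < (size s).+1) land_prob (nth 0%N bl j) (nth 0%N tl j)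
  = weight_from b0 t0 s.
  rewrite -gen; congr (_ * _); rewrite big_mkcond /=.
  by apply: eq_bigr => j _; rewrite if_neg.
rewrite {}/bl {}/tl; elim: s b0 t0 => [|p s IHs] b0 t0 /=.
  by rewrite !big_nil mulr1.
rewrite -(IHs p.1 p.2) !big_add1 /= !(big_nat_recl (size s)) //= /step_prob.
by ring.
Qed.

Variable phi : nat -> nat -> R.

(* The letter of the new word at position n - 1: x is its current value, and
   an entry (n, t) of the overwriting sequence replaces it by t. *)
Definition track_penult x s : nat :=
  foldl (fun x' (p : X) => if p.1 == n :> nat then val p.2 else x') x s.

(** Sum of weight times [phi] over the continuations of [(b0, t0)] by at most [m] pairs. The first
    summand is the empty continuation, allowed only when position n + 1 has been hit. *)
Fixpoint expect_from m b0 t0 x : R :=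
  (if b0 == n.+1 then phi x t0 else 0) +
  if m is m'.+1 then
    \sum_(t0.+1 <= t < T.+1) \sum_(b0.+1 <= b < n.+2 | (t < letter w b)%N)
       step_prob b0 t0 b t * expect_from m' b t (if b == n then t else x)
  else 0.

Lemma sum_overwriting_from m b0 t0 x :
  \sum_(B : m.-bseq X | overwriting_from b0 t0 B)
     weight_from b0 t0 B * phi (track_penult x B) (last t0 [seq val p.2 | p <- B])
  = expect_from m b0 t0 x.
Proof.
rewrite big_mkcond /=.
elim: m b0 t0 x => [|m IHm] b0 t0 x /=.
  rewrite (big_bseq0 (fun s => if overwriting_from b0 t0 s then
    weight_from b0 t0 s * phi (track_penult x s) (last t0 [seq val p.2 | p <- s])
    else 0)).
  by rewrite /overwriting_from /= andbT addr0 mul1r.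
rewrite (big_bseqS (fun s => if overwriting_from b0 t0 s then
    weight_from b0 t0 s * phi (track_penult x s) (last t0 [seq val p.2 | p <- s])
    else 0)).
congr (_ + _); first by rewrite /overwriting_from /= andbT mul1r.
transitivity (\sum_(p : X | (t0 < p.2)%N && ((p.2 < letter w p.1)%N && (b0 < p.1)%N))
   step_prob b0 t0 p.1 p.2 *
   expect_from m p.1 p.2 (if p.1 == n :> nat then val p.2 else x)).
  rewrite [RHS]big_mkcond /=; apply: eq_bigr => p _.
  case okp: [&& (t0 < p.2)%N, (p.2 < letter w p.1)%N & (b0 < p.1)%N]; last first.
    rewrite big1 // => B _; rewrite overwriting_from_cons.
    by move: okp; case: (b0 < p.1)%N; case: (t0 < p.2)%N;
      case: (p.2 < letter w p.1)%N.
  rewrite -IHm mulr_sumr; apply: eq_bigr => B _; rewrite overwriting_from_cons.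
  move: okp => /and3P[-> -> ->] /=; case: ifP => _; last by rewrite mulr0.
  by rewrite mulrA.
under [RHS]eq_bigr => t _ do rewrite big_geq_mkord.
rewrite big_geq_mkord (exchange_big_dep xpredT) //= pair_big_dep /=.
by apply: eq_big => [[b t]|[b t] _] //=.
Qed.

Lemma expect_from_end m t x : expect_from m n.+1 t x = phi x t.
Proof.
case: m => [|m] /=; rewrite eqxx ?addr0 //.
by rewrite big1 ?addr0 // => t' _; rewrite big_geq.
Qed.

(** Type [t0.+1] either lands or fails. A failure consumes no pair, so the bound [m.+1] is kept. *)
Lemma expect_from_step m b0 t0 x : (b0 <= n)%N -> (t0 < T)%N ->
  expect_from m.+1 b0 t0 x =
    \sum_(b0.+1 <= b < n.+2 | (t0.+1 < letter w b)%N)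
      land_prob b t0.+1 * expect_from m b t0.+1 (if b == n then t0.+1 else x)
    + fail_prob b0 t0.+1 * expect_from m.+1 b0 t0.+1 x.
Proof.
move=> b0n t0T /=; rewrite ltn_eqF ?ltnS // !add0r big_ltn //; congr (_ + _).
  by apply: eq_bigr => b _; rewrite /step_prob big_geq // mul1r.
rewrite mulr_sumr; apply: eq_big_nat => t /andP[t0t tT].
rewrite mulr_sumr; apply: eq_bigr => b _.
by rewrite mulrA /step_prob big_ltn // !mulrA.
Qed.

Lemma expect_from_geq m b0 t0 x : (b0 <= n)%N -> (T <= t0)%N ->
  expect_from m b0 t0 x = 0.
Proof.
move=> b0n Tt0; case: m => [|m] /=; rewrite ltn_eqF ?ltnS // !add0r //.
by rewrite big_geq.
Qed.

(* Until position n is overwritten, position n - 1 of the new word holds w_n. *)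
Lemma expect_from_unique (G : nat -> nat -> nat -> R) :
  (forall t x, G n.+1 t x = phi x t) ->
  (forall b0 t0 x, (0 < b0 <= n)%N -> (t0 < T)%N ->
     ((b0 < n)%N -> x = letter w n) ->
     G b0 t0 x = \sum_(b0.+1 <= b < n.+2 | (t0.+1 < letter w b)%N)
        land_prob b t0.+1 * G b t0.+1 (if b == n then t0.+1 else x)
       + fail_prob b0 t0.+1 * (if (t0.+1 < T)%N then G b0 t0.+1 x else 0)) ->
  forall m b0 t0 x, (0 < b0 <= n)%N -> (n < m + b0)%N -> (t0 < T)%N ->
    ((b0 < n)%N -> x = letter w n) -> expect_from m b0 t0 x = G b0 t0 x.
Proof.
move=> G_end G_step m b0 t0 x.
(* Induction on the number of untried types. The bound [n < m + b0] leaves enough pairs, since every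
   landing moves strictly right. *)
have [k] := ubnP (T - t0); elim: k m b0 t0 x => // k IHk m b0 t0 x leTk b0n nm t0T xw.
case: m nm => [|m] nm; first lia.
have b0n' : (b0 <= n)%N by lia.
rewrite expect_from_step // (G_step b0) //; congr (_ + _ * _); last first.
  by case: ltnP => t0T1; [apply: IHk => //; lia | rewrite expect_from_geq].
apply: congr_big_nat => // b /andP[lt_b bn]; congr (_ * _).
have [->|b_neq] := eqVneq b n.+1; first by rewrite expect_from_end G_end.
(* A landing at position n or before forces [t0.+1 < letter w b <= T], so the type stays below
   [T]. *)
have letb : (letter w b <= T)%N.
  rewrite /letter (nth_map (Ordinal t0T)) ?size_tuple; last lia.
  by rewrite ltn_ord.
apply: IHk; try lia.
by move=> ltbn; rewrite ltn_eqF //; apply: xw; lia.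
Qed.

End OneStep.

(** * The recursion on ball types and its solutions *)

Section Letters.
Variables (n T : nat) (w : word n T).

Lemma letter_last : letter w n.+1 = T.+1.
Proof. by rewrite /letter nth_default // size_map size_tuple. Qed.

Lemma letter_bounds m : (0 < m <= n)%N -> (0 < letter w m <= T)%N.
Proof.
move=> mn; rewrite /letter.
have /(mem_nth T.+1) : (m.-1 < size [seq (val a).+1 | a <- w])%N.
  by rewrite size_map size_tuple; lia.
by case/mapP => a _ ->; rewrite ltn_ord.
Qed.

Lemma J_last t : J w n.+1 t = 1%N.
Proof. by rewrite /J /index_iota subnn. Qed.

Lemma J_rec b t : (b <= n)%N -> J w b t = ((t < letter w b) + J w b.+1 t)%N.
Proof. by move=> bn; rewrite /J /index_iota subSn //= subSS addnCA. Qed.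

Lemma J_bounds b t : (0 < b)%N -> (b <= n.+1)%N -> (0 < J w b t <= n.+2 - b)%N.
Proof.
move=> b0 bn; rewrite /J.
have := count_size (fun l => t < letter w l)%N (index_iota b n.+1).
by rewrite size_iota; lia.
Qed.

End Letters.

Lemma partial_sumS (R : realFieldType) (z : nat -> R) k :
  partial_sum z k.+1 = partial_sum z k + z k.+1.
Proof. by rewrite /partial_sum big_nat_recr. Qed.

Lemma partial_sum1 (R : realFieldType) (z : nat -> R) : partial_sum z 1 = z 1%N.
Proof. by rewrite /partial_sum big_nat1. Qed.

Section LastLetters.
Variables (R : realFieldType) (n T : nat) (z : nat -> R) (w : word n T).
Local Notation z1 := (z 1%N).
Local Notation z2 := (z 2%N).
Local Notation y2 := (partial_sum z 2).

(** Going left from position n + 1, the available positions have [J] equal to 1, 2, 3 and so on, so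
    consecutive [z] values are added. *)
Lemma sum_land_prob b0 t : (b0 <= n)%N -> (t < T)%N ->
  \sum_(b0.+1 <= b < n.+2 | (t < letter w b)%N) land_prob z w b t =
  partial_sum z (J w b0.+1 t).
Proof.
move=> b0n tT.
have landE b : land_prob z w b t = z (J w b t) by rewrite /land_prob ltn_eqF.
have [k] := ubnP (n - b0); elim: k b0 b0n => // k IHk b0 b0n lek.
rewrite big_ltn_cond //; have [->|nb] := eqVneq b0 n.
  rewrite big_geq // letter_last ltnS (ltnW tT) addr0 landE J_last.
  by rewrite partial_sum1.
rewrite (IHk b0.+1) ?landE; try lia.
rewrite [J w b0.+1 t]J_rec; last lia.
by case: (t < letter w b0.+1)%N; rewrite //= add1n partial_sumS addrC.
Qed.

(** Landing and failure have total mass 1, so after subtracting [h] only positions n and n + 1 can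
    deviate; their [J] values are 2 (if n is available) and 1. *)
Lemma sum_land_fail b0 t (H : nat -> R) h : (b0 <= n)%N -> (t < T)%N ->
  (forall b, (b0 < b < n)%N -> H b = h) ->
  \sum_(b0.+1 <= b < n.+2 | (t < letter w b)%N) land_prob z w b t * H b
    + fail_prob z w b0 t * h =
  z1 * H n.+1 + if (b0 < n)%N && (t < letter w n)%N
                then z2 * H n + (1 - y2) * h else (1 - z1) * h.
Proof.
move=> b0n tT Hh.
have landE b : land_prob z w b t = z (J w b t) by rewrite /land_prob ltn_eqF.
have -> : \sum_(b0.+1 <= b < n.+2 | (t < letter w b)%N) land_prob z w b t * H b
  = \sum_(b0.+1 <= b < n.+2 | (t < letter w b)%N) land_prob z w b t * (H b - h)
    + partial_sum z (J w b0.+1 t) * h.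
  rewrite -sum_land_prob // mulr_suml -big_split /=.
  by apply: eq_bigr => b _; ring.
rewrite big_mkcond /= big_nat_recr //= letter_last ltnS (ltnW tT) landE J_last.
rewrite /fail_prob; have [b0ltn|nb0] := ltnP b0 n; last first.
  by rewrite big_geq //=; ring.
rewrite big_nat_recr //= big1_seq; last first.
  move=> b; rewrite mem_index_iota /= => b0b.
  by rewrite Hh // subrr mulr0 if_same.
rewrite landE (J_rec w) // J_last partial_sumS partial_sum1.
by case: (t < letter w n)%N => /=; ring.
Qed.

(** No letter exceeds [T], so type [T] fits only under the infinite value at position n + 1. *)
Lemma sum_land_final b0 (H : nat -> R) : (b0 <= n)%N ->
  \sum_(b0.+1 <= b < n.+2 | (T < letter w b)%N) land_prob z w b T * H b = H n.+1.
Proof.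
move=> b0n; rewrite big_mkcond /= big_nat_recr //= letter_last ltnSn.
rewrite /land_prob eqxx mul1r big1_seq ?add0r // => b; rewrite mem_index_iota /= => bb.
have /andP[_ bT] : (0 < letter w b <= T)%N by apply: letter_bounds; lia.
by rewrite ltnNge bT.
Qed.

Lemma expect_tail i m b0 t0 x : (i < T)%N -> (0 < b0 <= n)%N -> (n < m + b0)%N ->
  (t0 < T)%N -> ((b0 < n)%N -> x = letter w n) ->
  expect_from z w (fun _ t => (i < t)%:R) m b0 t0 x = (1 - z1) ^+ (i - t0).
Proof.
move=> iT b0n nm t0T xw.
(* Types [t + 1] to [i] must all miss the last place, each with factor [1 - z1]. Truncated
   subtraction gives exponent 0 once [i <= t]. *)
pose G b t (_ : nat) : R := if b == n.+1 then (i < t)%:R else (1 - z1) ^+ (i - t).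
rewrite (@expect_from_unique _ _ _ _ _ _ G) //; first by rewrite /G ltn_eqF //; lia.
  by move=> t ?; rewrite /G eqxx.
move=> {xw nm m t0T x b0n b0 t0} b0 t0 x b0n t0T _.
have b0n' : (b0 <= n)%N by lia.
case: (ltnP t0.+1 T) => t0T1; last first.
  have -> : t0.+1 = T by lia.
  rewrite mulr0 addr0 sum_land_final // /G eqxx ltn_eqF // iT.
  by have -> : (i - t0 = 0)%N by lia.
rewrite (sum_land_fail (H := fun b => G b t0.+1 (if b == n then t0.+1 else x))
          (h := G b0 t0.+1 x)) //.
  rewrite /G eqxx !ltn_eqF // partial_sumS partial_sum1.
  transitivity (z1 * (i < t0.+1)%:R + (1 - z1) * (1 - z1) ^+ (i - t0.+1)); last first.
    by case: ifP => _ /=; ring.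
  case: ltnP => it0.
    have [-> ->] : (i - t0 = 0 /\ i - t0.+1 = 0)%N by lia.
    by rewrite !expr0 /=; ring.
  have -> : (i - t0 = (i - t0.+1).+1)%N by lia.
  by rewrite exprS /=; ring.
by move=> b bb; rewrite /G !ltn_eqF //; lia.
Qed.

Variables i j : nat.
Hypotheses (iT : (0 < i <= T)%N) (jT : (0 < j <= T)%N).

(** Chance that the last letter becomes [j] once the types up to [t] have missed the last place:
    types [t + 1] to [j - 1] miss it and [j] takes it, by force when [j = T]. *)
Definition last_prob t : R :=
  if (t < j)%N then (1 - z1) ^+ (j - 1 - t) * (if (j < T)%N then z1 else 1) else 0.

(* Probability that the new word ends in i j when the types up to t have been
   tried, all landing strictly left of the position holding the old last
   letter c. *)
Definition pair_prob c t : R :=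
  if c == i then
    if (t < j)%N then (if (j < T)%N then z1 else 1) *
      (1 - y2) ^+ (minn i j - 1 - t) * (1 - z1) ^+ (j - 1 - maxn t (i - 1))
    else 0
  else if [&& t < i, i < j & i < c]%N then
    (1 - y2) ^+ (i - 1 - t) * z2 * last_prob i
  else 0.

Lemma last_prob_step t : (t.+1 < T)%N ->
  last_prob t = z1 * (t.+1 == j)%:R + (1 - z1) * last_prob t.+1.
Proof.
move=> tT; rewrite /last_prob; case: (ltngtP t.+1 j) => tj.
- have -> : (j - 1 - t = (j - 1 - t.+1).+1)%N by lia.
  by rewrite exprS /=; ring.
- by rewrite /=; ring.
- rewrite -tj tT subSS subn0 subnn.
  by rewrite expr0 /=; ring.
Qed.

Lemma last_prob_final t : t.+1 = T -> last_prob t = (T == j)%:R.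
Proof.
move=> tT; rewrite /last_prob; have [jj|jj] := eqVneq T j.
  rewrite -jj -tT ltnSn ltnn; have -> : (t.+1 - 1 - t = 0)%N by lia.
  by rewrite expr0 mul1r.
by have -> : (t < j)%N = false by lia.
Qed.

(** Type [t.+1] takes the last place with probability [z1]. If it is below [c], it overwrites [c]
    with probability [z2], after which only the last letter is open, and misses both places with
    probability [1 - y2]; otherwise the place of [c] is closed to it. *)
Lemma pair_prob_step c t : (t.+1 < T)%N ->
  pair_prob c t = z1 * ((c == i) && (t.+1 == j))%:R +
    if (t.+1 < c)%N then z2 * ((t.+1 == i)%:R * last_prob t.+1)
                         + (1 - y2) * pair_prob c t.+1
    else (1 - z1) * pair_prob c t.+1.
Proof.
move=> tT; rewrite /pair_prob; have [->|ci] /= := eqVneq c i.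
  case: (ltngtP t.+1 j) => tj.
  - case: (ltnP t.+1 i) => ti.
      rewrite (ltn_eqF ti).
      have -> : (minn i j - 1 - t = (minn i j - 1 - t.+1).+1)%N by lia.
      have -> : maxn t (i - 1) = maxn t.+1 (i - 1) by lia.
      by rewrite exprS /=; ring.
    (* Here [c = i <= t.+1]: the place of [c] can no longer be overwritten, so a miss costs only a
       factor [1 - z1]. *)
    have [-> ->] : (minn i j - 1 - t = 0 /\ minn i j - 1 - t.+1 = 0)%N by lia.
    have -> : (j - 1 - maxn t (i - 1) = (j - 1 - maxn t.+1 (i - 1)).+1)%N by lia.
    by rewrite exprS expr0 /=; ring.
  - rewrite /last_prob; have -> : (t.+1 < j)%N = false by lia.
    by case: ifP => _ /=; ring.
  - rewrite /last_prob -tj ltnn tT.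
    have [-> ->] : (minn i t.+1 - 1 - t = 0 /\ t.+1 - 1 - maxn t (i - 1) = 0)%N.
      by lia.
    by rewrite !expr0 /=; case: ifP => _ /=; ring.
(* With [c] different from [i], the type [i] must overwrite [c], which needs [i < c], and the last
   letter [j] then comes from a later, larger type. *)
have [/andP[ij ic]|nij] := boolP ((i < j) && (i < c))%N; last first.
  rewrite !andbF; case: (ltnP t.+1 c) => tc; last by rewrite /=; ring.
  have [ti|_] := eqVneq t.+1 i; last by rewrite /=; ring.
  rewrite /last_prob; have -> : (t.+1 < j)%N = false by lia.
  by rewrite /=; ring.
rewrite !andbT; case: (ltngtP t.+1 i) => ti.
- have -> : (t.+1 < c)%N by lia.
  have -> : (i - 1 - t = (i - 1 - t.+1).+1)%N by lia.
  by rewrite exprS /=; ring.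
- by case: ifP => _ /=; ring.
- have -> : (t.+1 < c)%N by lia.
  have -> : (i - 1 - t = 0)%N by lia.
  by rewrite ti expr0 /=; ring.
Qed.

Lemma pair_prob_final c t : t.+1 = T ->
  pair_prob c t = ((c == i) && (T == j))%:R.
Proof.
move=> tT; rewrite /pair_prob; have [_|ci] /= := eqVneq c i; last first.
  by case: ifP => //; lia.
have [jj|jj] := eqVneq T j; last by have -> : (t < j)%N = false by lia.
rewrite -jj -tT ltnSn ltnn.
have [-> ->] : (minn i t.+1 - 1 - t = 0 /\ t.+1 - 1 - maxn t (i - 1) = 0)%N by lia.
by rewrite !mulr1.
Qed.

Lemma expect_pair m b0 t0 : (0 < b0 < n)%N -> (n < m + b0)%N -> (t0 < T)%N ->
  expect_from z w (fun x t => ((x == i) && (t == j))%:R) m b0 t0 (letter w n) =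
  pair_prob (letter w n) t0.
Proof.
move=> b0n nm t0T.
(* Three regimes: the last place is filled; the old last letter is overwritten and only the last
   place is open; all landings are strictly left of the old last letter. *)
pose G b t x : R := if b == n.+1 then ((x == i) && (t == j))%:R
  else if b == n then (x == i)%:R * last_prob t else pair_prob (letter w n) t.
rewrite (@expect_from_unique _ _ _ _ _ _ G) //; try lia.
- by rewrite /G !ltn_eqF //; lia.
- by move=> t x; rewrite /G eqxx.
move=> {nm m t0T b0n b0 t0} b0 t0 x b0n t0T xw.
have b0n' : (b0 <= n)%N by lia.
have Gn1 t y : G n.+1 t y = ((y == i) && (t == j))%:R by rewrite /G eqxx.
have Gn t y : G n t y = (y == i)%:R * last_prob t by rewrite /G ltn_eqF // eqxx.
have Glt b t y : (b < n)%N -> G b t y = pair_prob (letter w n) t.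
  by move=> bn; rewrite /G !ltn_eqF //; lia.
have n1n : (n.+1 == n) = false by lia.
case: (ltnP t0.+1 T) => t0T1; last first.
  have t0T' : t0.+1 = T by lia.
  rewrite t0T' mulr0 addr0 sum_land_final // Gn1 n1n.
  case: (ltnP b0 n) => b0n1; first by rewrite Glt // pair_prob_final // xw.
  have -> : b0 = n by lia.
  by rewrite Gn last_prob_final // -natrM mulnb.
rewrite (sum_land_fail (H := fun b => G b t0.+1 (if b == n then t0.+1 else x))
          (h := G b0 t0.+1 x)) //; last first.
  by move=> b bb; rewrite !Glt //; lia.
rewrite Gn1 n1n eqxx Gn; case: (ltnP b0 n) => b0n1 /=.
  by rewrite !Glt // pair_prob_step // xw.
have -> : b0 = n by lia.
rewrite !Gn last_prob_step //; by case: (x == i) => /=; ring.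
Qed.

End LastLetters.

(** * The overwriting chain *)

Section Overwrite.
Variables (n T : nat) (w : word n T).

Lemma letter_tnth (v : word n T) (i : 'I_n) : letter v i.+1 = (tnth v i).+1.
Proof.
rewrite /letter /=; have x0 := tnth v i.
by rewrite (nth_map x0) ?size_tuple // (tnth_nth x0).
Qed.

Lemma word_letterP (v v' : word n T) :
  (forall i, (0 < i <= n)%N -> letter v i = letter v' i) -> v = v'.
Proof.
move=> eq_vv'; apply: eq_from_tnth => i; apply: val_inj; apply: succn_inj.
by rewrite -!letter_tnth; apply: eq_vv' => /=.
Qed.

Lemma track_penultE x (s : seq ('I_n.+2 * 'I_T.+1)) :
  uniq [seq val p.1 | p <- s] ->
  track_penult x s = if n \in [seq val p.1 | p <- s]
    then nth 0%N [seq val p.2 | p <- s] (index n [seq val p.1 | p <- s]) else x.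
Proof.
rewrite /track_penult; elim: s x => //= p s IHs x /andP[np us].
rewrite inE IHs // [n == _]eq_sym.
have [p_n|//] := eqVneq (val p.1) n; move: np; rewrite p_n => /negPf.
by move=> /= ->.
Qed.

Section OverwritingSequence.
Variable B : pair_seq n T.
Hypothesis B_ok : overwriting w B.

Lemma uniq_bs : uniq (bs B).
Proof.
case/and4P: B_ok => + _ _ _; rewrite path_sortedE; last exact: ltn_trans.
by case/andP=> _; apply: sorted_uniq => //; [apply: ltn_trans | apply: ltnn].
Qed.

Lemma overwrite_last : (0 < n)%N -> overwrite w B n = last 0%N (ts B).
Proof.
move=> n_gt0; have := uniq_bs; case/and4P: B_ok => _ /eqP + _ _.
rewrite /overwrite /bs /ts; case: (bseqval B) => [|p s]; first by move=> /=; lia.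
move: (size_map (fun q => val q.1) s) (size_map (fun q => val q.2) s).
rewrite !map_cons; move: [seq val q.1 | q <- s] [seq val q.2 | q <- s] => bl tl.
move=> sz_bl sz_tl b_last up.
have := mem_last (val p.1) bl; have := index_last up.
rewrite [last _ bl]b_last => -> ->.
by rewrite sz_bl -sz_tl -[RHS](nth_last 0%N (val p.2 :: tl)).
Qed.

Lemma overwrite_penult : (1 < n)%N ->
  overwrite w B n.-1 = track_penult (letter w n) B.
Proof.
by move=> n_gt1; rewrite track_penultE ?uniq_bs // /overwrite prednK //; lia.
Qed.

Lemma overwrite_bounds i : (0 < i <= n)%N -> (0 < overwrite w B i <= T)%N.
Proof.
move=> i_n; case/and4P: B_ok => _ /eqP b_last t_path _; rewrite /overwrite.
case: ifP => i_bs; last first.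
  have [eq_in|neq_in] := eqVneq i n; last by apply: letter_bounds; lia.
  (* Position n would read the default [T.+1], but n + 1 is the last landing position, so this case
     is void. *)
  rewrite eq_in in i_bs; have := mem_last 1%N (bs B).
  by rewrite b_last inE i_bs orbF => /eqP; lia.
set t := nth _ _ _.
have t_in : t \in ts B.
  by rewrite /t mem_nth // size_map -(size_map (fun p => val p.1)) index_mem.
apply/andP; split.
  by move: (order_path_min ltn_trans t_path) => /allP /(_ _ t_in).
by case/mapP: t_in => p _ ->; rewrite -ltnS ltn_ord.
Qed.

Lemma exists_overwrite : exists w', is_overwrite w B w'.
Proof.
have bnd (i : 'I_n) : ((overwrite w B i.+1).-1 < T)%N.
  by have := @overwrite_bounds i.+1; have := ltn_ord i; lia.
exists [tuple Ordinal (bnd i) | i < n]; apply/forallP => i.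
rewrite letter_tnth tnth_mktuple /= prednK //.
by have := @overwrite_bounds i.+1; have := ltn_ord i; lia.
Qed.

End OverwritingSequence.

Lemma is_overwriteP B (w' : word n T) i : is_overwrite w B w' ->
  (0 < i <= n)%N -> letter w' i = overwrite w B i.
Proof.
move=> /forallP ow; case: i => // i i_n.
by have /eqP := ow (Ordinal (i_n : (i < n)%N)).
Qed.

(** Each overwriting sequence produces exactly one word, so exchanging the sums leaves one term per
    sequence. *)
Lemma sum_transition (R : realFieldType) (z : nat -> R) (A : pred (word n T))
    (phi : nat -> nat -> R) :
  (forall B w', overwriting w B -> is_overwrite w B w' ->
     (A w')%:R = phi (track_penult (letter w n) B) (last 0%N (ts B))) ->
  \sum_(w' | A w') transition z w w' = expect_from z w phi n 1 0 (letter w n).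
Proof.
move=> A_phi; rewrite -sum_overwriting_from /transition.
rewrite (exchange_big_dep (fun B => overwriting w B)) /=; last first.
  by move=> ? ? _ /andP[].
apply: eq_bigr => B B_ok; rewrite -weightE.
have [w0 w0B] := exists_overwrite B_ok.
rewrite -(A_phi _ _ B_ok w0B) [LHS](eq_bigl (fun w' => A w' && (w' == w0))).
  by rewrite big_mkcondl big_pred1_eq; case: (A w0); rewrite ?mulr1 ?mulr0.
move=> w'; rewrite B_ok /=; congr (_ && _); apply/idP/eqP => [w'B|-> //].
by apply: word_letterP => i i_n; rewrite !(@is_overwriteP B).
Qed.

End Overwrite.

(** * Positivity, row sums and accessibility of the constant word *)

Section OverwritingChain.
Variables (R : realFieldType) (n T : nat) (z : nat -> R).
Hypotheses (n_gt0 : (0 < n)%N) (T_gt0 : (0 < T)%N).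
Hypothesis z_gt0 : forall i : nat, (1 <= i <= n.+1)%N -> 0 < z i.
Hypothesis z_sum : \sum_(1 <= i < n.+2) z i = 1.
Implicit Types w : word n T.

Lemma partial_sum_lt1 k : (k <= n)%N -> partial_sum z k < 1.
Proof.
move=> kn; rewrite -z_sum (@big_cat_nat _ _ _ k.+1) //=; last lia.
rewrite -[ltLHS]addr0 ltrD2l big_nat_recr //=.
apply: ltr_wpDl; last by apply: z_gt0; rewrite /= leqnn.
by rewrite big_seq sumr_ge0 // => i; rewrite mem_index_iota => ?; apply/ltW/z_gt0; lia.
Qed.

(** As [b >= 1], the index [J] is at most n, so the partial sum misses the positive term
    [z n.+1]. *)
Lemma fail_prob_gt0 w b l : (0 < b <= n)%N -> 0 < fail_prob z w b l.
Proof.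
move=> b_n; rewrite subr_gt0 partial_sum_lt1 //.
by have := @J_bounds n T w b.+1 l; lia.
Qed.

Lemma land_prob_ge0 w b t : (0 < b <= n.+1)%N -> 0 <= land_prob z w b t.
Proof.
move=> b_n; rewrite /land_prob; case: ifP => // _; apply/ltW/z_gt0.
by have := @J_bounds n T w b t; lia.
Qed.

Lemma weight_from_ge0 w b0 t0 s : (0 < b0)%N -> overwriting_from w b0 t0 s ->
  0 <= weight_from z w b0 t0 s.
Proof.
elim: s b0 t0 => //= p s IHs b0 t0 b0_gt0.
rewrite overwriting_from_cons => /and4P[b0p t0p _ ok].
have p_n := ltn_ord p.1.
rewrite mulr_ge0 ?IHs //; last lia.
rewrite mulr_ge0 ?land_prob_ge0 //; last lia.
by apply: prodr_ge0 => l _; apply/ltW/fail_prob_gt0; lia.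
Qed.

Lemma transition_ge0 w w' : 0 <= transition z w w'.
Proof.
apply: sumr_ge0 => B /andP[B_ok _]; rewrite weightE.
exact: weight_from_ge0.
Qed.

Lemma sum_transition_tail w i : (i < T)%N ->
  \sum_(w' : word n T | (i < letter w' n)%N) transition z w w' = (1 - z 1%N) ^+ i.
Proof.
move=> iT; rewrite (@sum_transition _ _ _ _ _ _ (fun _ t => (i < t)%:R)).
  by rewrite expect_tail ?subn0 // ?addn1.
move=> B w' B_ok w'B; rewrite (is_overwriteP w'B) ?n_gt0 ?leqnn //.
by rewrite overwrite_last.
Qed.

Lemma transition_row w : \sum_w' transition z w w' = 1.
Proof.
rewrite -[RHS](expr0 (1 - z 1%N)) -(sum_transition_tail w T_gt0).
apply: eq_bigl => w'; have := @letter_bounds n T w' n.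
by rewrite n_gt0 leqnn => /(_ isT) /andP[].
Qed.

(* All balls fail, so a letter T is appended. *)
Lemma exists_append_T w : exists2 w', 0 < transition z w w' &
  letter w' n = T /\ forall i, (0 < i < n)%N -> letter w' i = letter w i.+1.
Proof.
pose p : 'I_n.+2 * 'I_T.+1 := (ord_max, ord_max).
pose B : pair_seq n T := Bseq (n_gt0 : (size [:: p] <= n)%N).
have B_ok : overwriting w B.
  by rewrite /overwriting /= ltnS n_gt0 eqxx T_gt0 letter_last ltnSn.
have [w' w'B] := exists_overwrite B_ok; exists w'; last split.
- rewrite /transition (bigD1 B) /=; last by rewrite B_ok.
  apply: ltr_pwDl; last first.
    apply: sumr_ge0 => C /andP[/andP[C_ok _] _]; rewrite weightE.
    exact: weight_from_ge0.
  rewrite weightE /= mulr1 /step_prob /land_prob eqxx mulr1.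
  by apply: prodr_gt0 => l _; apply: fail_prob_gt0; lia.
- by rewrite (is_overwriteP w'B) ?overwrite_last //; lia.
- move=> i i_n; rewrite (is_overwriteP w'B); last lia.
  by rewrite /overwrite /bs /= inE; case: eqP => //; lia.
Qed.

Lemma connect_const_T (wT : word n T) : (forall i, (0 < i <= n)%N -> letter wT i = T) ->
  forall w, connect (fun v v' => 0 < transition z v v') w wT.
Proof.
move=> wT_T w.
(* [k] bounds the leading positions not known to hold [T]; appending a [T] shifts the final block
   left and lowers [k] by one. *)
suff gen k v : (forall i, (k < i <= n)%N -> letter v i = T) ->
    connect (fun v v' => 0 < transition z v v') v wT.
  by apply: (gen n) => i; lia.
elim: k v => [|k IHk] v v_T.
  have -> : v = wT by apply: word_letterP => i i_n; rewrite v_T // wT_T.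
  exact: connect0.
have [v' vv' [v'n v'i]] := exists_append_T v.
apply: connect_trans (connect1 vv') (IHk _ _) => i i_n.
have [->//|neq] := eqVneq i n; rewrite v'i; last lia.
by apply: v_T; lia.
Qed.

Lemma exists_unique_stationary : exists2 pi : {ffun word n T -> R},
  stationary z pi & forall pi', stationary z pi' -> pi' = pi.
Proof.
have T_pred : (T.-1 < T)%N by rewrite ltn_predL.
pose wT : word n T := [tuple Ordinal T_pred | i < n].
have wT_T i : (0 < i <= n)%N -> letter wT i = T.
  case: i => // i i_n.
  by rewrite (letter_tnth wT (Ordinal (i_n : (i < n)%N))) tnth_mktuple /= prednK.
have conn := connect_const_T wT_T.
have [pi [pi_ge0 pi_sum pi_inv]] :=
  exists_invariant_distribution transition_ge0 transition_row wT.
exists pi => // pi' [pi'_ge0 pi'_sum pi'_inv]; apply/ffunP => w; apply/eqP.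
rewrite -subr_eq0; apply/eqP.
(* The difference of two stationary distributions is invariant with total 0. *)
apply: (invariant_vec_eq0 transition_ge0 transition_row conn
  (v := fun w => pi' w - pi w)).
  move=> w'; under eq_bigr => v _ do rewrite mulrBl.
  by rewrite sumrB pi'_inv pi_inv.
by rewrite sumrB pi_sum pi'_sum subrr.
Qed.

(** * Laws of the last letters under stationarity *)

Section Marginals.
Variable pi : {ffun word n T -> R}.
Hypothesis pi_stat : stationary z pi.
Local Notation z1 := (z 1%N).
Local Notation y2 := (partial_sum z 2).

Lemma prob_step (A : pred (word n T)) :
  prob pi A = \sum_w pi w * \sum_(w' | A w') transition z w w'.
Proof.
case: pi_stat => _ _ pi_inv; rewrite /prob.
under eq_bigr => w' _ do rewrite -pi_inv.
by rewrite exchange_big; apply: eq_bigr => w _; rewrite mulr_sumr.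
Qed.

Lemma prob_tail i : (i < T)%N -> prob pi (fun w => (i < letter w n)%N) = (1 - z1) ^+ i.
Proof.
move=> iT; rewrite prob_step; under eq_bigr => w _ do rewrite sum_transition_tail //.
by case: pi_stat => _ pi_sum _; rewrite -mulr_suml pi_sum mul1r.
Qed.

Lemma prob_last j : (0 < j <= T)%N -> prob pi (fun w => letter w n == j) =
  if (j < T)%N then z1 * (1 - z1) ^+ (j - 1) else (1 - z1) ^+ (T - 1).
Proof.
move=> j_T; have letn w : (0 < letter w n <= T)%N.
  by apply: letter_bounds; rewrite n_gt0 leqnn.
(* For [j = T] the event is the tail above [T - 1]; for smaller [j] it is a difference of two
   tails. *)
case: ltnP => jT; last first.
  rewrite -prob_tail; last lia.
  by apply: eq_bigl => w; have := letn w; lia.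
have -> : prob pi (fun w => letter w n == j) =
    prob pi (fun w => (j - 1 < letter w n)%N) - prob pi (fun w => (j < letter w n)%N).
  apply/eqP; rewrite eq_sym subr_eq /prob (bigID (fun w => letter w n == j)) /=.
  by apply/eqP; congr (_ + _); apply: eq_bigl => w; lia.
rewrite !prob_tail; try lia.
have -> : (1 - z1) ^+ j = (1 - z1) * (1 - z1) ^+ (j - 1).
  by rewrite -exprS; congr (_ ^+ _); lia.
by ring.
Qed.

Lemma prob_pair i j : (1 < n)%N -> (0 < i <= T)%N -> (0 < j <= T)%N ->
  prob pi (fun w => (letter w (n - 1) == i) && (letter w n == j)) =
    \sum_w pi w * pair_prob T z i j (letter w n) 0.
Proof.
move=> n_gt1 i_T j_T; rewrite prob_step; apply: eq_bigr => w _; congr (_ * _).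
rewrite (@sum_transition _ _ _ _ _ _ (fun x t => ((x == i) && (t == j))%:R)).
  by rewrite expect_pair // ?addn1.
move=> B w' B_ok w'B; rewrite !(is_overwriteP w'B); try lia.
by rewrite overwrite_last // subn1 overwrite_penult.
Qed.

Lemma prob_last_pair i j : (1 < n)%N -> (0 < i <= T)%N -> (0 < j <= T)%N ->
  prob pi (fun w => (letter w (n - 1) == i) && (letter w n == j)) =
    (1 - z1) ^+ (maxn i j - 1) * (1 - y2) ^+ (minn i j - 1) *
    (if (i < j < T)%N then z1 * y2
     else if (j <= i < T)%N then z1 ^+ 2
     else if (i < j)%N && (j == T) then y2
     else if (j < i)%N && (i == T) then z1
     else 1).
Proof.
move=> n_gt1 i_T j_T; rewrite prob_pair //.
have sumE (A : pred (word n T)) : \sum_w pi w * (A w)%:R = prob pi A.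
  rewrite /prob [RHS]big_mkcond; apply: eq_bigr => w _.
  by case: (A w); rewrite ?mulr1 ?mulr0.
pose zeta : R := if (j < T)%N then z1 else 1.
case: (ltnP i j) => ij.
  pose u := (1 - z1) ^+ (j - 1 - i).
  (* Only [c = i] (the letter is kept) and [c > i] (it is overwritten by [i]) contribute. Their
     probabilities [z1 (1 - z1)^(i - 1)] and [(1 - z1)^i] combine to give the factor
     [z1 + z2 = y2]. *)
  have pairE c : pair_prob T z i j c 0 =
      zeta * (1 - y2) ^+ (i - 1) * (u * (1 - z1)) * (c == i)%:R
      + (1 - y2) ^+ (i - 1) * z 2%N * (u * zeta) * (i < c)%:R.
    rewrite /pair_prob /last_prob ij (_ : (0 < j)%N); last lia.
    rewrite (_ : (0 < i)%N); last lia.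
    rewrite /= max0n !subn0 (_ : minn i j = i); last lia.
    rewrite (_ : (j - 1 - (i - 1) = (j - 1 - i).+1)%N); last lia.
    rewrite exprS -/zeta -/u.
    have [->|_] := eqVneq c i; first by rewrite ltnn /=; ring.
    by case: ltnP => _ /=; ring.
  under eq_bigr => w _ do rewrite pairE mulrDr !(mulrCA (pi w)).
  rewrite big_split /= -!mulr_sumr.
  rewrite (sumE (fun w => letter w n == i)) (sumE (fun w => (i < letter w n)%N)).
  rewrite prob_last // prob_tail; last lia.
  rewrite (_ : (i < T)%N); last lia.
  have -> : (j - 1 = (j - 1 - i) + (i - 1).+1)%N by lia.
  have -> : (1 - z1) ^+ i = (1 - z1) * (1 - z1) ^+ (i - 1).
    by rewrite -exprS; congr (_ ^+ _); lia.
  rewrite exprD exprS -/u partial_sumS partial_sum1 /zeta.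
  case: (ltnP j T) => jT /=; first by ring.
  by rewrite (_ : (j == T)); [ring | lia].
(* With [j <= i], overwriting by [i] would force a last letter above [i], so the old last letter
   must be [i] itself. *)
have pairE c : pair_prob T z i j c 0 =
    zeta * (1 - y2) ^+ (j - 1) * (c == i)%:R.
  rewrite /pair_prob (_ : (0 < j)%N); last lia.
  rewrite (ltnNge i j) ij andbF /= max0n !subn0 (_ : minn i j = j); last lia.
  rewrite (_ : (j - 1 - (i - 1) = 0)%N); last lia.
  by case: eqP; rewrite ?mulr1 ?mulr0.
under eq_bigr => w _ do rewrite pairE mulrCA.
rewrite -!mulr_sumr (sumE (fun w => letter w n == i)) prob_last // /zeta.
case: (ltnP i T) => iT /=.
  by rewrite (_ : (j < T)%N); [ring | lia].
have -> : i = T by lia.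
rewrite eqxx andbT; case: (ltnP j T) => jT /=; ring.
Qed.

End Marginals.
End OverwritingChain.

Theorem theorem3p8 (R : realFieldType) (n T : nat) (z : nat -> R)
  (n_ge1 : (1 <= n)%N) (T_ge1 : (1 <= T)%N)
  (z_gt0 : forall i : nat, (1 <= i <= n.+1)%N -> 0 < z i)
  (z_sum : \sum_(1 <= i < n.+2) z i = 1) :
  let z1 := z 1%N in
  let y2 := partial_sum z 2 in
  exists pi : {ffun word n T -> R},
    [/\ stationary z pi,
        forall pi' : {ffun word n T -> R}, stationary z pi' -> pi' = pi,
        forall j : nat, (1 <= j <= T)%N ->
          prob pi (fun w => letter w n == j) =
            if (j < T)%N then z1 * (1 - z1) ^+ (j - 1)
            else (1 - z1) ^+ (T - 1)
      & (2 <= n)%N ->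
        forall i j : nat, (1 <= i <= T)%N -> (1 <= j <= T)%N ->
          prob pi (fun w => (letter w (n - 1) == i) && (letter w n == j)) =
            (1 - z1) ^+ (maxn i j - 1) * (1 - y2) ^+ (minn i j - 1) *
            (if (i < j < T)%N then z1 * y2
             else if (j <= i < T)%N then z1 ^+ 2
             else if (i < j)%N && (j == T) then y2
             else if (j < i)%N && (i == T) then z1
             else 1)].
Proof.
move=> z1 y2.
have [pi pi_stat pi_uniq] := exists_unique_stationary n_ge1 T_ge1 z_gt0 z_sum.
exists pi; split=> //.
- by move=> j j_T; apply: prob_last.
- by move=> n_gt1 i j i_T j_T; apply: prob_last_pair.
Qed.
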